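(* Let $\mathcal W$ be a class of objects of $\mathcal C$ which is closed under finite direct sums and under hokernels of $\xi$-deflations. Let $$X\xrightarrow{x}X^0\xrightarrow{y}X^1\overset{\delta}{\dashrightarrow}\qquad (T)$$ be an $\mathbb E$-triangle in $\xi$, and let $$\cdots\to W_i^0\to\cdots\to W_1^0\to W_0^0\to X^0\to 0\qquad (R^0)$$ $$\cdots\to W_i^1\to\cdots\to W_1^1\to W_0^1\to X^1\to 0\qquad (R^1)$$ be proper $\mathcal W(\xi)$-resolutions of $X^0$ and $X^1$, respectively. (1) There are an object $W\in\mathcal W$, a proper $\mathcal W(\xi)$-resolution of $X$ of the form $$\cdots\to W_{i+1}^1\oplus W_i^0\to\cdots\to W_2^1\oplus W_1^0\to W\to X\to 0\qquad (R)$$ and an $\mathbb E$-triangle $W\to W_1^1\oplus W_0^0\to W_0^1\dashrightarrow$ in $\xi$. (2) If, in addition, the $\xi$-exact complexes $(R^0)$, $(R^1)$ and the $\mathbb E$-triangle $(T)$ are $\mathcal C(-,\mathcal W)$-exact, then so is the complex $(R)$ obtained in (1) (that is, the data in (1) can be taken such that $(R)$ is moreover $\mathcal C(-,\mathcal W)$-exact).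
   Context: Extriangulated categories (Nakaoka–Palu). Let $\mathcal C$ be an additive category with an additive bifunctor $\mathbb E:\mathcal C^{\mathrm{op}}\times\mathcal C\to\mathrm{Ab}$. For $\delta\in\mathbb E(C,A)$, $a:A\to A'$, $c:C'\to C$ write $a_*\delta=\mathbb E(C,a)(\delta)$, $c^*\delta=\mathbb E(c,A)(\delta)$. For $\delta\in\mathbb E(C,A)$, $\delta'\in\mathbb E(C',A')$, a morphism $(a,c):\delta\to\delta'$ is a pair $a:A\to A'$, $c:C\to C'$ with $a_*\delta=c^*\delta'$. Two sequences $A\xrightarrow{x}B\xrightarrow{y}C$ and $A\xrightarrow{x'}B'\xrightarrow{y'}C$ are equivalent if there is an isomorphism $b:B\to B'$ with $bx=x'$, $y'b=y$. A realization $\mathfrak s$ assigns to each $\delta\in\mathbb E(C,A)$ an equivalence class $\mathfrak s(\delta)=[A\xrightarrow{x}B\xrightarrow{y}C]$ such that for every morphism $(a,c):\delta\to\delta'$ with $\mathfrak s(\delta)=[A\xrightarrow{x}B\xrightarrow{y}C]$, $\mathfrak s(\delta')=[A'\xrightarrow{x'}B'\xrightarrow{y'}C']$ there is $b:B\to B'$ with $bx=x'a$, $y'b=cy$. It is additive if $\mathfrak s(0)=[A\to A\oplus C\to C]$ (canonical maps) and $\mathfrak s(\delta\oplus\delta')=\mathfrak s(\delta)\oplus\mathfrak s(\delta')$. If $\mathfrak s(\delta)=[A\xrightarrow{x}B\xrightarrow{y}C]$, one calls $A\xrightarrow{x}B\xrightarrow{y}C\overset{\delta}{\dashrightarrow}$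 an $\mathbb E$-triangle, $x$ an inflation and $y$ a deflation. $(\mathcal C,\mathbb E,\mathfrak s)$ is extriangulated if $\mathfrak s$ is an additive realization and: (ET3) for $\mathbb E$-triangles $A\xrightarrow{x}B\xrightarrow{y}C\overset{\delta}{\dashrightarrow}$ and $A'\xrightarrow{x'}B'\xrightarrow{y'}C'\overset{\delta'}{\dashrightarrow}$ and morphisms $a:A\to A'$, $b:B\to B'$ with $bx=x'a$ there is $c:C\to C'$ with $cy=y'b$ and $a_*\delta=c^*\delta'$; (ET3)$^{\mathrm{op}}$ the dual; (ET4) for $\mathbb E$-triangles $A\xrightarrow{f}B\xrightarrow{f'}D\overset{\delta}{\dashrightarrow}$ and $B\xrightarrow{g}C\xrightarrow{g'}F\overset{\delta'}{\dashrightarrow}$ there are an $\mathbb E$-triangle $A\xrightarrow{gf}C\xrightarrow{h'}H\overset{\delta''}{\dashrightarrow}$ and morphisms $d:D\to H$, $e:H\to F$ with $h'g=df'$, $eh'=g'$, such that $D\xrightarrow{d}H\xrightarrow{e}F$ realizes $f'_*\delta'$, $d^*\delta''=\delta$ and $f_*\delta''=e^*\delta'$; (ET4)$^{\mathrm{op}}$ the dual. Proper classes. An $\mathbb E$-triangle is split if $\delta=0$. A class $\xi$ of $\mathbb E$-triangles closed under isomorphisms is a proper class if: (i) it is closed under finite coproducts and contains all split $\mathbb E$-triangles; (ii) it is closed under base change (if the $\mathbb E$-triangle realizing $\delta\in\mathbb E(C,A)$ is in $\xi$ and $c:C'\to C$, then any $\mathbb E$-triangle realizing $c^*\delta$ is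 in $\xi$) and cobase change (likewise for $a_*\delta$, $a:A\to A'$); (iii) it is saturated: if $A_1\to B_1\to C\overset{\delta_1}{\dashrightarrow}$ and $A_2\to B_2\xrightarrow{y_2}C\overset{\delta_2}{\dashrightarrow}$ are $\mathbb E$-triangles such that the second one and the $\mathbb E$-triangle $A_1\to M\to B_2\overset{y_2^*\delta_1}{\dashrightarrow}$ are in $\xi$, then the first one is in $\xi$. If $A\xrightarrow{x}B\xrightarrow{y}C\dashrightarrow$ is in $\xi$, then $x$ is a $\xi$-inflation, $y$ a $\xi$-deflation, $x$ is the hokernel of $y$ and $y$ the hocokernel of $x$. An object $P$ is $\xi$-projective if $0\to\mathcal C(P,A)\to\mathcal C(P,B)\to\mathcal C(P,C)\to0$ is exact for every $\mathbb E$-triangle $A\to B\to C\dashrightarrow$ in $\xi$; $\xi$-injective is dual. $\mathcal C$ has enough $\xi$-projectives (resp. $\xi$-injectives) if each object $A$ admits an $\mathbb E$-triangle $K\to P\to A\dashrightarrow$ (resp. $A\to I\to K\dashrightarrow$) in $\xi$ with $P$ $\xi$-projective (resp. $I$ $\xi$-injective). Standing assumptions. $(\mathcal C,\mathbb E,\mathfrak s)$ is an extriangulated category, $\xi$ is a proper class of $\mathbb E$-triangles, $\mathcal C$ has enough $\xi$-projectives and enough $\xi$-injectives, and Condition (WIC) holds: for composable $f,g$, if $gf$ is an inflation then so is $f$, and if $gf$ is a deflation then so is $g$. Exactness. For a class $\mathcal W$ of objects, an $\mathbb E$-triangle $A\to B\to C\dashrightarrow$ in $\xi$ is $\mathcal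 C(\mathcal W,-)$-exact (resp. $\mathcal C(-,\mathcal W)$-exact) if $0\to\mathcal C(W,A)\to\mathcal C(W,B)\to\mathcal C(W,C)\to0$ (resp. $0\to\mathcal C(C,W)\to\mathcal C(B,W)\to\mathcal C(A,W)\to0$) is exact for all $W\in\mathcal W$. Resolutions. A $\mathcal W(\xi)$-resolution of $A$ is a $\xi$-exact complex $\cdots\to W_1\xrightarrow{d_1}W_0\xrightarrow{d_0}A\to0$ with all $W_i\in\mathcal W$; $\xi$-exact means there are $\mathbb E$-triangles $K_{i+1}\xrightarrow{g_i}W_i\xrightarrow{f_i}K_i\dashrightarrow$ in $\xi$ ($i\ge0$) with $K_0=A$, $d_0=f_0$ and $d_i=g_{i-1}f_i$ for $i\ge1$. The complex is $\mathcal C(\mathcal W,-)$-exact (resp. $\mathcal C(-,\mathcal W)$-exact) if these $\mathbb E$-triangles can be chosen $\mathcal C(\mathcal W,-)$-exact (resp. $\mathcal C(-,\mathcal W)$-exact). A $\mathcal W(\xi)$-resolution is proper if it is $\mathcal C(\mathcal W,-)$-exact. $\mathcal W$ is closed under hokernels of $\xi$-deflations if for each $\mathbb E$-triangle $A\to B\to C\dashrightarrow$ in $\xi$ with $B,C\in\mathcal W$ one has $A\in\mathcal W$. *)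

(* Defs.v *)
From mathcomp Require Import all_boot ssralg.
Set Implicit Arguments.
Unset Strict Implicit.
Unset Printing Implicit Defensive.
Import GRing.Theory.
Local Open Scope ring_scope.

Declare Scope excat_scope.
Delimit Scope excat_scope with excat.
Open Scope excat_scope.

Reserved Notation "g ∘ f" (at level 40, left associativity).
Reserved Notation "A ⊕ B" (at level 50, left associativity).

Record addCat := AddCat {
  obj :> Type;
  mor : obj -> obj -> zmodType;
  idm : forall A, mor A A;
  mcomp : forall {A B C}, mor B C -> mor A B -> mor A C
    where "g ∘ f" := (mcomp g f);
  mcompA : forall A B C D (h : mor C D) (g : mor B C) (f : mor A B),
    h ∘ (g ∘ f) = (h ∘ g) ∘ f;
  mcomp1m : forall A B (f : mor A B), idm B ∘ f = f;
  mcompm1 : forall A B (f : mor A B), f ∘ idm A = f;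
  mcompDl : forall A B C (g g' : mor B C) (f : mor A B),
    (g + g') ∘ f = g ∘ f + g' ∘ f;
  mcompDr : forall A B C (g : mor B C) (f f' : mor A B),
    g ∘ (f + f') = g ∘ f + g ∘ f';
  zero_ob : obj;
  zero_obP : idm zero_ob = 0;
  biprod : obj -> obj -> obj;
  inj1 : forall {A B : obj}, mor A (biprod A B);
  inj2 : forall {A B : obj}, mor B (biprod A B);
  prj1 : forall {A B : obj}, mor (biprod A B) A;
  prj2 : forall {A B : obj}, mor (biprod A B) B;
  prj1_inj1 : forall A B : obj, @prj1 A B ∘ inj1 = idm A;
  prj2_inj2 : forall A B : obj, @prj2 A B ∘ inj2 = idm B;
  prj1_inj2 : forall A B : obj, @prj1 A B ∘ inj2 = 0;
  prj2_inj1 : forall A B : obj, @prj2 A B ∘ inj1 = 0;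
  biprod_id : forall A B : obj, inj1 ∘ prj1 + inj2 ∘ prj2 = idm (biprod A B)
}.

Notation "g ∘ f" := (mcomp g f) : excat_scope.
Notation "A ⊕ B" := (biprod A B) : excat_scope.
Arguments idm {_} A.
Arguments zero_ob {_}.

Definition is_iso (C : addCat) (A B : C) (f : mor A B) : Prop :=
  exists g : mor B A, g ∘ f = idm A /\ f ∘ g = idm B.

Definition sum_mor (C : addCat) (A A' B B' : C) (f : mor A B) (f' : mor A' B') :
  mor (A ⊕ A') (B ⊕ B') :=
  inj1 ∘ f ∘ prj1 + inj2 ∘ f' ∘ prj2.

Record addBifunctor (C : addCat) := AddBifunctor {
  ext :> C -> C -> zmodType;
  push : forall {Z A A' : C}, mor A A' -> ext Z A -> ext Z A';
  pull : forall {Z Z' A : C}, mor Z' Z -> ext Z A -> ext Z' A;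
  pushD : forall (Z A A' : C) (a : mor A A') (d d' : ext Z A),
    push a (d + d') = push a d + push a d';
  pullD : forall (Z Z' A : C) (c : mor Z' Z) (d d' : ext Z A),
    pull c (d + d') = pull c d + pull c d';
  push1 : forall (Z A : C) (d : ext Z A), push (idm A) d = d;
  pull1 : forall (Z A : C) (d : ext Z A), pull (idm Z) d = d;
  push_comp : forall (Z A A' A'' : C) (a' : mor A' A'') (a : mor A A')
    (d : ext Z A), push (a' ∘ a) d = push a' (push a d);
  pull_comp : forall (Z Z' Z'' A : C) (c : mor Z' Z) (c' : mor Z'' Z')
    (d : ext Z A), pull (c ∘ c') d = pull c' (pull c d);
  push_pull : forall (Z Z' A A' : C) (a : mor A A') (c : mor Z' Z)
    (d : ext Z A), push a (pull c d) = pull c (push a d);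
  push_addm : forall (Z A A' : C) (a a' : mor A A') (d : ext Z A),
    push (a + a') d = push a d + push a' d;
  pull_addm : forall (Z Z' A : C) (c c' : mor Z' Z) (d : ext Z A),
    pull (c + c') d = pull c d + pull c' d
}.

(* A diagram A --x--> B --y--> Z together with an arbitrary element of
   E(Z, A), which need not be realized by it. *)
Record triangle (C : addCat) (E : addBifunctor C) := Tri {
  tri1 : C;
  tri2 : C;
  tri3 : C;
  tri_x : mor tri1 tri2;
  tri_y : mor tri2 tri3;
  tri_d : E tri3 tri1
}.
Arguments Tri {C E tri1 tri2 tri3} tri_x tri_y tri_d.

Section Realization.
Variables (C : addCat) (E : addBifunctor C).

(* [s (Tri x y d)] stands for: the sequence (x, y) belongs to the equivalence
   class s(d), i.e. [Tri x y d] is an E-triangle. *)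
Variable s : triangle E -> Prop.

(* The element of E(Z (+) Z', A (+) A') with components (d, 0, 0, d'). *)
Definition sum_ext (Z Z' A A' : C) (d : E Z A) (d' : E Z' A') :
  E (Z ⊕ Z') (A ⊕ A') :=
  push inj1 (pull prj1 d) + push inj2 (pull prj2 d').

Definition seq_equiv (A B B' Z : C) (x : mor A B) (y : mor B Z)
    (x' : mor A B') (y' : mor B' Z) : Prop :=
  exists b : mor B B', [/\ is_iso b, b ∘ x = x' & y' ∘ b = y].

Definition realization : Prop :=
  (forall (A Z : C) (d : E Z A),
     exists (B0 : C) (x0 : mor A B0) (y0 : mor B0 Z),
     forall (B : C) (x : mor A B) (y : mor B Z),
       s (Tri x y d) <-> seq_equiv x0 y0 x y) /\
  (forall (A B Z A' B' Z' : C)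
     (x : mor A B) (y : mor B Z) (d : E Z A)
     (x' : mor A' B') (y' : mor B' Z') (d' : E Z' A')
     (a : mor A A') (c : mor Z Z'),
     s (Tri x y d) -> s (Tri x' y' d') -> push a d = pull c d' ->
     exists b : mor B B', b ∘ x = x' ∘ a /\ y' ∘ b = c ∘ y).

Definition additive_realization : Prop :=
  [/\ realization,
      (forall A Z : C, s (Tri (@inj1 C A Z) (@prj2 C A Z) 0))
    & forall (A B Z A' B' Z' : C)
        (x : mor A B) (y : mor B Z) (d : E Z A)
        (x' : mor A' B') (y' : mor B' Z') (d' : E Z' A'),
        s (Tri x y d) -> s (Tri x' y' d') ->
        s (Tri (sum_mor x x') (sum_mor y y') (sum_ext d d'))].

Definition ET3 : Prop :=
  forall (A B Z A' B' Z' : C)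
    (x : mor A B) (y : mor B Z) (d : E Z A)
    (x' : mor A' B') (y' : mor B' Z') (d' : E Z' A')
    (a : mor A A') (b : mor B B'),
    s (Tri x y d) -> s (Tri x' y' d') -> b ∘ x = x' ∘ a ->
    exists c : mor Z Z', c ∘ y = y' ∘ b /\ push a d = pull c d'.

Definition ET3op : Prop :=
  forall (A B Z A' B' Z' : C)
    (x : mor A B) (y : mor B Z) (d : E Z A)
    (x' : mor A' B') (y' : mor B' Z') (d' : E Z' A')
    (b : mor B B') (c : mor Z Z'),
    s (Tri x y d) -> s (Tri x' y' d') -> c ∘ y = y' ∘ b ->
    exists a : mor A A', b ∘ x = x' ∘ a /\ push a d = pull c d'.

Definition ET4 : Prop :=
  forall (A B Z D F : C)
    (f : mor A B) (f' : mor B D) (d : E D A)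
    (g : mor B Z) (g' : mor Z F) (d' : E F B),
    s (Tri f f' d) -> s (Tri g g' d') ->
    exists (H : C) (h' : mor Z H) (d'' : E H A) (u : mor D H) (v : mor H F),
      s (Tri (g ∘ f) h' d'') /\ h' ∘ g = u ∘ f' /\ v ∘ h' = g' /\
      s (Tri u v (push f' d')) /\ pull u d'' = d /\
      push f d'' = pull v d'.

Definition ET4op : Prop :=
  forall (A B Z D F : C)
    (f' : mor D B) (f : mor B A) (d : E A D)
    (g' : mor F Z) (g : mor Z B) (d' : E B F),
    s (Tri f' f d) -> s (Tri g' g d') ->
    exists (H : C) (h' : mor H Z) (d'' : E A H) (u : mor H D) (v : mor F H),
      s (Tri h' (f ∘ g) d'') /\ g ∘ h' = f' ∘ u /\ h' ∘ v = g' /\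
      s (Tri v u (pull f' d')) /\ push u d'' = d /\
      pull f d'' = push v d'.

End Realization.

Record extriCat := ExtriCat {
  base_cat :> addCat;
  Ext : addBifunctor base_cat;
  etri : triangle Ext -> Prop;
  etri_realization : additive_realization etri;
  etri_ET3 : ET3 etri;
  etri_ET3op : ET3op etri;
  etri_ET4 : ET4 etri;
  etri_ET4op : ET4op etri
}.

Section Extriangulated.
Variable C : extriCat.

Definition inflation (A B : C) (x : mor A B) : Prop :=
  exists (Z : C) (y : mor B Z) (d : Ext C Z A), etri (Tri x y d).

Definition deflation (B Z : C) (y : mor B Z) : Prop :=
  exists (A : C) (x : mor A B) (d : Ext C Z A), etri (Tri x y d).

Definition WIC : Prop :=
  (forall (A B Z : C) (f : mor A B) (g : mor B Z),
     inflation (g ∘ f) -> inflation f) /\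
  (forall (A B Z : C) (f : mor A B) (g : mor B Z),
     deflation (g ∘ f) -> deflation g).

(* Closure under finite coproducts is stated for binary ones: the empty
   coproduct is a split E-triangle. *)
Record proper_class (xi : triangle (Ext C) -> Prop) : Prop := ProperClass {
  proper_etri : forall t, xi t -> etri t;
  proper_iso : forall (A B Z A' B' Z' : C)
    (x : mor A B) (y : mor B Z) (d : Ext C Z A)
    (x' : mor A' B') (y' : mor B' Z') (d' : Ext C Z' A')
    (a : mor A A') (b : mor B B') (c : mor Z Z'),
    is_iso a -> is_iso b -> is_iso c ->
    b ∘ x = x' ∘ a -> c ∘ y = y' ∘ b -> push a d = pull c d' ->
    etri (Tri x' y' d') -> xi (Tri x y d) -> xi (Tri x' y' d');
  proper_sum : forall (A B Z A' B' Z' : C)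
    (x : mor A B) (y : mor B Z) (d : Ext C Z A)
    (x' : mor A' B') (y' : mor B' Z') (d' : Ext C Z' A'),
    xi (Tri x y d) -> xi (Tri x' y' d') ->
    xi (Tri (sum_mor x x') (sum_mor y y') (sum_ext d d'));
  proper_split : forall (A B Z : C) (x : mor A B) (y : mor B Z),
    etri (Tri x y (0 : Ext C Z A)) -> xi (Tri x y (0 : Ext C Z A));
  proper_base_change : forall (A B Z B' Z' : C)
    (x : mor A B) (y : mor B Z) (d : Ext C Z A) (c : mor Z' Z)
    (x' : mor A B') (y' : mor B' Z'),
    xi (Tri x y d) -> etri (Tri x' y' (pull c d)) ->
    xi (Tri x' y' (pull c d));
  proper_cobase_change : forall (A B Z A' B' : C)
    (x : mor A B) (y : mor B Z) (d : Ext C Z A) (a : mor A A')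
    (x' : mor A' B') (y' : mor B' Z),
    xi (Tri x y d) -> etri (Tri x' y' (push a d)) ->
    xi (Tri x' y' (push a d));
  proper_saturated : forall (A1 B1 A2 B2 M Z : C)
    (x1 : mor A1 B1) (y1 : mor B1 Z) (d1 : Ext C Z A1)
    (x2 : mor A2 B2) (y2 : mor B2 Z) (d2 : Ext C Z A2)
    (m : mor A1 M) (n : mor M B2),
    etri (Tri x1 y1 d1) -> xi (Tri x2 y2 d2) ->
    xi (Tri m n (pull y2 d1)) -> xi (Tri x1 y1 d1)
}.

(* Exactness of 0 -> U -> V -> T -> 0, for additive f and g. *)
Definition short_exact (U V T : zmodType) (f : U -> V) (g : V -> T) : Prop :=
  [/\ injective f,
      (forall v, g v = 0 <-> exists u, v = f u)
    & (forall w, exists v, w = g v)].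

Definition hom_from_exact (P : C) (t : triangle (Ext C)) : Prop :=
  short_exact (fun h : mor P (tri1 t) => tri_x t ∘ h)
              (fun h : mor P (tri2 t) => tri_y t ∘ h).

Definition hom_to_exact (I : C) (t : triangle (Ext C)) : Prop :=
  short_exact (fun h : mor (tri3 t) I => h ∘ tri_y t)
              (fun h : mor (tri2 t) I => h ∘ tri_x t).

Variable xi : triangle (Ext C) -> Prop.

Definition xi_projective (P : C) : Prop :=
  forall t, xi t -> hom_from_exact P t.

Definition xi_injective (I : C) : Prop :=
  forall t, xi t -> hom_to_exact I t.

Definition enough_projectives : Prop :=
  forall A : C, exists (K P : C) (x : mor K P) (y : mor P A) (d : Ext C A K),
    xi (Tri x y d) /\ xi_projective P.

Definition enough_injectives : Prop :=
  forall A : C, exists (I K : C) (x : mor A I) (y : mor I K) (d : Ext C K A),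
    xi (Tri x y d) /\ xi_injective I.

Variable W : C -> Prop.

Definition from_exact (t : triangle (Ext C)) : Prop :=
  forall V : C, W V -> hom_from_exact V t.

Definition to_exact (t : triangle (Ext C)) : Prop :=
  forall V : C, W V -> hom_to_exact V t.

Definition closed_finite_sums : Prop :=
  W zero_ob /\ forall A B : C, W A -> W B -> W (A ⊕ B).

Definition closed_hokernels : Prop :=
  forall (A B Z : C) (x : mor A B) (y : mor B Z) (d : Ext C Z A),
    xi (Tri x y d) -> W B -> W Z -> W A.

(* A sequence ... -> T_1 -> T_0 -> A, where [res_diff i] : T_(i+1) -> T_i. *)
Record res_seq (A : C) := ResSeq {
  res_term : nat -> C;
  res_aug : mor (res_term 0) A;
  res_diff : forall i, mor (res_term i.+1) (res_term i)
}.

(* The sequence A, K 0, K 1, ...: the syzygy K_(i+1) is encoded as [K i], so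
   that the requirement K_0 = A holds by computation. *)
Definition syzygy (A : C) (K : nat -> C) (i : nat) : C :=
  if i is j.+1 then K j else A.

(* The sequence is spliced from triangles satisfying [P]; that consecutive
   maps compose to zero follows when these are E-triangles. *)
Definition spliced (P : triangle (Ext C) -> Prop) (A : C) (R : res_seq A) :
    Prop :=
  exists (K : nat -> C)
         (f : forall i, mor (res_term R i) (syzygy A K i))
         (g : forall i, mor (K i) (res_term R i))
         (d : forall i, Ext C (syzygy A K i) (K i)),
    [/\ forall i, P (Tri (g i) (f i) (d i)),
        res_aug R = f 0%N
      & forall i, res_diff R i = g i ∘ f i.+1].

Definition xi_exact (A : C) (R : res_seq A) : Prop := spliced xi R.

Definition from_exact_seq (A : C) (R : res_seq A) : Prop :=
  spliced (fun t => xi t /\ from_exact t) R.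

Definition to_exact_seq (A : C) (R : res_seq A) : Prop :=
  spliced (fun t => xi t /\ to_exact t) R.

Definition resolution (A : C) (R : res_seq A) : Prop :=
  (forall i, W (res_term R i)) /\ xi_exact R.

Definition proper_resolution (A : C) (R : res_seq A) : Prop :=
  resolution R /\ from_exact_seq R.

Definition shifted_sum_terms (V : C) (T0 T1 : nat -> C) (i : nat) : C :=
  if i is j.+1 then T1 j.+2 ⊕ T0 j.+1 else V.

End Extriangulated.

Arguments ResSeq {C A} res_term res_aug res_diff.

(* Main.v *)
Require Import Defs.
From mathcomp Require Import all_boot ssralg.
From Stdlib Require Import ClassicalEpsilon.

Set Implicit Arguments.
Unset Strict Implicit.
Unset Printing Implicit Defensive.
Import GRing.Theory.

(** Write K_i and L_i for the syzygies of the resolutions of X^0 and X^1, so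
    that L_1 -> W_0^1 -> X^1 is the first E-triangle of the second one.  Pulling
    (T) and this E-triangle back along each other gives an object M with two
    E-triangles, X -> M -> W_0^1 and L_1 -> M -> X^0 ([etri_base_change]).  The
    second is C(W,-)-exact, being a base change of one that is, so the horseshoe
    lemma ([horseshoe]) combines the resolutions of L_1 and X^0 into one of M
    with terms W_(i+1)^1 (+) W_i^0.  Let L -> W_1^1 (+) W_0^0 -> M be its first
    E-triangle.  The composite of the two deflations
    W_1^1 (+) W_0^0 -> M -> W_0^1 has a hokernel V by (ET4)^op, and the same
    axiom presents L -> V -> X as the base change of
    L -> W_1^1 (+) W_0^0 -> M along X -> M.  So V belongs to W, and the
    resolution of M becomes one of X once its first term is replaced by V
    ([shifted_resolution]).

    Every E-triangle built on the way arises from given ones by base change and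
    by composing deflations through (ET4)^op.  Hence it is enough to know that a
    class of E-triangles is stable under these two operations
    ([base_closed]).  This is so for xi (composition uses saturation), for the
    C(W,-)-exact E-triangles, and for the C(-,W)-exact ones; in the last case the
    point is that base change preserves deflations that can be cancelled from
    maps into objects of W ([base_change_relative_epi]).  Part (1) is the construction for the class of
    the C(W,-)-exact E-triangles of xi, part (2) for those that are
    also C(-,W)-exact.

    In part (2) the two kinds of exactness of a resolution are witnessed by two
    splicings which could differ, since an inflation need not be monic.  However,
    C(W,-)-exactness makes the inflations monic with respect to objects of W,
    which forces the two splicings to be isomorphic ([spliced_from_exact]).

    The following argument replaces the five lemma.  If an endomorphism h of one
    term of an E-triangle is compatible with identities on the other terms, then
    h - 1 factors through a map y with y (h - 1) = 0.  So (h - 1)^2 = 0 and h is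
    invertible. *)

(** * Additivity of composition and of the bifunctor *)

Section Additive.
Local Open Scope ring_scope.
Variable C : addCat.

Lemma mcomp0m (A B D : C) (f : mor A B) : (0 : mor B D) ∘ f = 0.
Proof. by apply: (addrI (0 ∘ f)); rewrite -mcompDl !addr0. Qed.

Lemma mcompm0 (A B D : C) (g : mor B D) : g ∘ (0 : mor A B) = 0.
Proof. by apply: (addrI (g ∘ 0)); rewrite -mcompDr !addr0. Qed.

Lemma mcompNl (A B D : C) (g : mor B D) (f : mor A B) : (- g) ∘ f = - (g ∘ f).
Proof. by apply: (addrI (g ∘ f)); rewrite -mcompDl !subrr mcomp0m. Qed.

Lemma mcompNr (A B D : C) (g : mor B D) (f : mor A B) : g ∘ (- f) = - (g ∘ f).
Proof. by apply: (addrI (g ∘ f)); rewrite -mcompDr !subrr mcompm0. Qed.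

Lemma mcompBl (A B D : C) (g g' : mor B D) (f : mor A B) :
  (g - g') ∘ f = g ∘ f - g' ∘ f.
Proof. by rewrite mcompDl mcompNl. Qed.

Lemma mcompBr (A B D : C) (g : mor B D) (f f' : mor A B) :
  g ∘ (f - f') = g ∘ f - g ∘ f'.
Proof. by rewrite mcompDr mcompNr. Qed.

Lemma biprod_eq (A B D : C) (f g : mor D (A ⊕ B)) :
  prj1 ∘ f = prj1 ∘ g -> prj2 ∘ f = prj2 ∘ g -> f = g.
Proof.
move=> e1 e2; rewrite -(mcomp1m f) -(mcomp1m g) -biprod_id !mcompDl -!mcompA.
by rewrite e1 e2.
Qed.

Lemma is_iso_id (A : C) : is_iso (idm A).
Proof. by exists (idm A); rewrite mcomp1m. Qed.

Lemma is_iso_comp (A B D : C) (g : mor B D) (f : mor A B) :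
  is_iso g -> is_iso f -> is_iso (g ∘ f).
Proof.
move=> [g' [g'g gg']] [f' [f'f ff']]; exists (f' ∘ g'); split.
  by rewrite mcompA -(mcompA f') g'g mcompm1.
by rewrite mcompA -(mcompA g) ff' mcompm1.
Qed.

(** If (h - 1)^2 = 0 then 2 - h inverts h; so both composites of f and g are
    invertible. *)
Lemma is_iso_sqr0 (A B : C) (f : mor A B) (g : mor B A) :
  (g ∘ f - idm A) ∘ (g ∘ f - idm A) = 0 ->
  (f ∘ g - idm B) ∘ (f ∘ g - idm B) = 0 -> is_iso f.
Proof.
have inv (D : C) (h : mor D D) : (h - idm D) ∘ (h - idm D) = 0 ->
    (idm D + idm D - h) ∘ h = idm D /\ h ∘ (idm D + idm D - h) = idm D.
  move=> h2; have hh : h ∘ h = h + h - idm D.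
    move: h2; rewrite mcompBl !mcompBr !mcomp1m !mcompm1 => /eqP.
    by rewrite subr_eq0 subr_eq => /eqP ->; rewrite addrAC.
  rewrite mcompBl mcompBr mcompDl mcompDr !mcomp1m !mcompm1 hh.
  by rewrite opprB addrC subrK.
move=> /inv [l1 _] /inv [_ r2].
set s := (_ - _) in l1; set t := (_ - _) in r2.
have sg : s ∘ g = g ∘ t.
  by rewrite -[s ∘ g]mcompm1 -r2 !mcompA -(mcompA s) l1 mcomp1m.
by exists (s ∘ g); split; [rewrite -mcompA | rewrite sg mcompA].
Qed.

Variable E : addBifunctor C.

Lemma push0 (Z A A' : C) (a : mor A A') : push a (0 : E Z A) = 0.
Proof. by apply: (addrI (push a 0)); rewrite -pushD !addr0. Qed.

Lemma pull0 (Z Z' A : C) (c : mor Z' Z) : pull c (0 : E Z A) = 0.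
Proof. by apply: (addrI (pull c 0)); rewrite -pullD !addr0. Qed.

Lemma push_0m (Z A A' : C) (d : E Z A) : push (0 : mor A A') d = 0.
Proof. by apply: (addrI (push 0 d)); rewrite -push_addm !addr0. Qed.

Lemma push_subm (Z A A' : C) (a a' : mor A A') (d : E Z A) :
  push (a - a') d = push a d - push a' d.
Proof. by apply: (addIr (push a' d)); rewrite -push_addm !subrK. Qed.

End Additive.

(** * The long exact sequences of an E-triangle *)

Section Exactness.
Local Open Scope ring_scope.
Variable C : extriCat.
Implicit Types A B Z V : C.

(** The split E-triangles are the test objects: applying (ET3), its dual or the
    realization property between them and a given E-triangle yields each piece
    of the two long exact sequences. *)
Lemma etri_split A Z : etri (Tri (@inj1 C A Z) (@prj2 C A Z) (0 : Ext C _ _)).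
Proof. by case: (etri_realization C) => _ + _; apply. Qed.

Lemma etri_morphism A B Z A' B' Z'
    (x : mor A B) (y : mor B Z) (d : Ext C Z A)
    (x' : mor A' B') (y' : mor B' Z') (d' : Ext C Z' A')
    (a : mor A A') (c : mor Z Z') :
  etri (Tri x y d) -> etri (Tri x' y' d') -> push a d = pull c d' ->
  exists b : mor B B', b ∘ x = x' ∘ a /\ y' ∘ b = c ∘ y.
Proof. by case: (etri_realization C) => [] [_ +] _ _; apply. Qed.

Lemma etri_exists A Z (d : Ext C Z A) :
  exists B (x : mor A B) (y : mor B Z), etri (Tri x y d).
Proof.
case: (etri_realization C) => [] [+ _] _ _ => /(_ A Z d) [B [x [y xyP]]].
exists B, x, y; apply/xyP; exists (idm B).
by split; [exact: is_iso_id | rewrite mcomp1m | rewrite mcompm1].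
Qed.

Lemma etri_equiv A B B' Z (x : mor A B) (y : mor B Z) (x' : mor A B')
    (y' : mor B' Z) (d : Ext C Z A) :
  etri (Tri x y d) -> seq_equiv x y x' y' -> etri (Tri x' y' d).
Proof.
case: (etri_realization C) => [] [+ _] _ _ => /(_ A Z d) [B0 [x0 [y0 xyP]]].
move=> /xyP [b [bI bx by_]] [b' [b'I b'x b'y]]; apply/xyP.
exists (b' ∘ b); split; first exact: is_iso_comp.
  by rewrite -mcompA bx.
by rewrite mcompA b'y.
Qed.

Lemma etri_unique A B B' Z (x : mor A B) (y : mor B Z) (x' : mor A B')
    (y' : mor B' Z) (d : Ext C Z A) :
  etri (Tri x y d) -> etri (Tri x' y' d) -> seq_equiv x y x' y'.
Proof.
case: (etri_realization C) => [] [+ _] _ _ => /(_ A Z d) [B0 [x0 [y0 xyP]]].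
move=> /xyP [b [[c [cb bc]] bx by_]] /xyP [b' [b'I b'x b'y]].
exists (b' ∘ c); split.
- by apply: is_iso_comp => //; exists b.
- by rewrite -bx -mcompA (mcompA c) cb mcomp1m.
- by rewrite mcompA b'y -by_ -mcompA bc mcompm1.
Qed.

Lemma etri_comp0 A B Z (x : mor A B) (y : mor B Z) (d : Ext C Z A) :
  etri (Tri x y d) -> y ∘ x = 0.
Proof.
move=> T; have [] := etri_ET3 (a := idm A) (b := x ∘ prj1) (etri_split A A) T.
  by rewrite -mcompA prj1_inj1.
move=> c [cE _]; have := congr1 (fun h => h ∘ inj1) cE.
by rewrite /= -!mcompA prj1_inj1 prj2_inj1 mcompm0 mcompm1.
Qed.

Lemma etri_weak_cokernel A B Z V (x : mor A B) (y : mor B Z) (d : Ext C Z A)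
    (h : mor B V) :
  etri (Tri x y d) -> h ∘ x = 0 -> exists r, h = r ∘ y.
Proof.
move=> T hx; have [] := etri_ET3 (a := (0 : mor A V)) (b := inj2 ∘ h) T
  (etri_split V V).
  by rewrite mcompm0 -mcompA hx mcompm0.
by move=> r [rE _]; exists r; rewrite rE mcompA prj2_inj2 mcomp1m.
Qed.

Lemma etri_weak_kernel A B Z V (x : mor A B) (y : mor B Z) (d : Ext C Z A)
    (h : mor V B) :
  etri (Tri x y d) -> y ∘ h = 0 -> exists r, h = x ∘ r.
Proof.
move=> T yh; have [] := etri_ET3op (b := h ∘ prj1) (c := (0 : mor V Z))
  (etri_split V V) T.
  by rewrite mcomp0m mcompA yh mcomp0m.
by move=> r [rE _]; exists r; rewrite -rE -mcompA prj1_inj1 mcompm1.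
Qed.

Lemma etri_push_x A B Z (x : mor A B) (y : mor B Z) (d : Ext C Z A) :
  etri (Tri x y d) -> push x d = 0.
Proof.
move=> T; have [//|] := etri_ET3 (a := x) (b := inj1) T (etri_split B B).
by move=> c [_ ->]; rewrite pull0.
Qed.

Lemma etri_pull_y A B Z (x : mor A B) (y : mor B Z) (d : Ext C Z A) :
  etri (Tri x y d) -> pull y d = 0.
Proof.
move=> T; have [//|] := etri_ET3op (b := prj2) (c := y) (etri_split B B) T.
by move=> a [_ <-]; rewrite push0.
Qed.

Lemma etri_lift A B Z V (x : mor A B) (y : mor B Z) (d : Ext C Z A)
    (c : mor V Z) :
  etri (Tri x y d) -> pull c d = 0 -> exists r, c = y ∘ r.
Proof.
move=> T cd; have [] := etri_morphism (a := (0 : mor V A)) (c := c)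
  (etri_split V V) T.
  by rewrite push0 cd.
move=> b [_ yb]; exists (b ∘ inj2).
by rewrite mcompA yb -mcompA prj2_inj2 mcompm1.
Qed.

Lemma etri_extend A B Z V (x : mor A B) (y : mor B Z) (d : Ext C Z A)
    (a : mor A V) :
  etri (Tri x y d) -> push a d = 0 -> exists r, a = r ∘ x.
Proof.
move=> T ad; have [] := etri_morphism (a := a) (c := (0 : mor Z V))
  T (etri_split V V).
  by rewrite pull0.
move=> b [bx _]; exists (prj1 ∘ b).
by rewrite -mcompA bx mcompA prj1_inj1 mcomp1m.
Qed.

(** The swap identifies this with the canonical split sequence of Z (+) A. *)
Lemma etri_split_op A Z : etri (Tri (@inj2 C A Z) (@prj1 C A Z) (0 : Ext C _ _)).
Proof.
pose swap U V : mor (U ⊕ V) (V ⊕ U) := inj1 ∘ prj2 + inj2 ∘ prj1.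
have s1 U V : prj1 ∘ swap U V = prj2.
  by rewrite mcompDr !mcompA prj1_inj1 prj1_inj2 mcomp0m mcomp1m addr0.
have s2 U V : prj2 ∘ swap U V = prj1.
  by rewrite mcompDr !mcompA prj2_inj1 prj2_inj2 mcomp0m mcomp1m add0r.
have sK U V : swap V U ∘ swap U V = idm _.
  by apply: biprod_eq; rewrite mcompA ?s1 ?s2 mcompm1.
apply: etri_equiv (etri_split Z A) _; exists (swap Z A); split=> //.
  by exists (swap A Z).
by rewrite mcompDl -!mcompA prj2_inj1 prj1_inj1 mcompm0 mcompm1 add0r.
Qed.

(** The map b - 1 kills x, so it factors through y; and y kills b - 1. *)
Lemma etri_middle_sqr0 A B Z (x : mor A B) (y : mor B Z) (d : Ext C Z A)
    (b : mor B B) : etri (Tri x y d) ->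
  b ∘ x = x -> y ∘ b = y -> (b - idm B) ∘ (b - idm B) = 0.
Proof.
move=> T bx yb; have [] := etri_weak_cokernel (h := b - idm B) T.
  by rewrite mcompBl mcomp1m bx subrr.
by move=> r {1}->; rewrite -mcompA mcompBr mcompm1 yb subrr mcompm0.
Qed.

(** A realization of d is compared with (x, c y) by the maps that c and its
    inverse induce on the middle terms; their composites are unipotent by
    [etri_middle_sqr0]. *)
Lemma etri_pull_iso A B Z Z' (x : mor A B) (y : mor B Z') (c : mor Z' Z)
    (d : Ext C Z A) :
  is_iso c -> etri (Tri x y (pull c d)) -> etri (Tri x (c ∘ y) d).
Proof.
move=> [c' [c'c cc']] T; have [B' [x' [y' T']]] := etri_exists d.
have [|b [bx y'b]] := etri_morphism (a := idm A) (c := c) T T'.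
  by rewrite push1.
have [|b' [b'x yb']] := etri_morphism (a := idm A) (c := c') T' T.
  by rewrite push1 -pull_comp cc' pull1.
apply: (etri_equiv T'); exists b'.
rewrite mcompm1 in bx; rewrite mcompm1 in b'x; split=> //.
- apply: (@is_iso_sqr0 C _ _ b' b).
    by apply: (etri_middle_sqr0 T'); rewrite -?mcompA ?b'x // mcompA y'b -mcompA
      yb' mcompA cc' mcomp1m.
  by apply: (etri_middle_sqr0 T); rewrite -?mcompA ?bx // mcompA yb' -mcompA
    y'b mcompA c'c mcomp1m.
- by rewrite -mcompA yb' mcompA cc' mcomp1m.
Qed.

End Exactness.

(** * Two E-triangles with a common end term *)

Section BaseChange.
Local Open Scope ring_scope.
Variable C : extriCat.
Implicit Types A B Z V : C.

(** This is (ET4) for the composite of the split inflation i with j.  It gives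
    the two E-triangles A -> N -> H and A' -> H -> Z; the latter realizes p_* d,
    so H may be replaced by B'.  The class of the former is found by
    retracting along r the compatibility that (ET4) gives after pushing along
    i. *)
Lemma etri_half_base_change (A S A' N Z B' : C)
    (i : mor A S) (p : mor S A') (r : mor S A)
    (j : mor S N) (q : mor N Z) (d : Ext C Z S)
    (x' : mor A' B') (y' : mor B' Z) :
  etri (Tri i p (0 : Ext C _ _)) -> r ∘ i = idm A ->
  etri (Tri j q d) -> etri (Tri x' y' (push p d)) ->
  exists h : mor N B', [/\ etri (Tri (j ∘ i) h (pull y' (push r d))),
    h ∘ j = x' ∘ p & y' ∘ h = q].
Proof.
move=> Tip ri T T'.
have [H [h [d'' [u [v [Th [hj [vh [Tuv [_ pd'']]]]]]]]]] := etri_ET4 Tip T.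
have [b [bI bu yb]] := etri_unique Tuv T'.
have d''E : d'' = pull b (pull y' (push r d)).
  by rewrite -pull_comp yb -push_pull -pd'' -push_comp ri push1.
rewrite d''E in Th; exists (b ∘ h); split.
- exact: etri_pull_iso Th.
- by rewrite -mcompA hj mcompA bu.
- by rewrite mcompA yb.
Qed.

(** The extension of Z by A1 (+) A2 with components d1 and d2 has a middle term N
    which, by [etri_half_base_change] for either summand, is an extension of B2
    by A1 and of B1 by A2 at once.  The given realization M of y2^* d1 is then
    identified with N. *)
Lemma etri_base_change (A1 B1 A2 B2 Z M : C)
    (x1 : mor A1 B1) (y1 : mor B1 Z) (d1 : Ext C Z A1)
    (x2 : mor A2 B2) (y2 : mor B2 Z) (d2 : Ext C Z A2)
    (m : mor A1 M) (n : mor M B2) :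
  etri (Tri x1 y1 d1) -> etri (Tri x2 y2 d2) ->
  etri (Tri m n (pull y2 d1)) ->
  exists (k : mor A2 M) (p : mor M B1),
    [/\ etri (Tri k p (pull y1 d2)), p ∘ m = x1 & y1 ∘ p = y2 ∘ n].
Proof.
move=> T1 T2 Tm; pose d : Ext C Z (A1 ⊕ A2) := push inj1 d1 + push inj2 d2.
have d1E : push prj1 d = d1.
  by rewrite pushD -!push_comp prj1_inj1 prj1_inj2 push1 push_0m addr0.
have d2E : push prj2 d = d2.
  by rewrite pushD -!push_comp prj2_inj1 prj2_inj2 push1 push_0m add0r.
have [N [j [q T]]] := etri_exists d.
have [|h2 [Th2 h2j yh2]] := etri_half_base_change (x' := x2) (y' := y2)
  (etri_split A1 A2) (prj1_inj1 A1 A2) T; first by rewrite d2E.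
have [|h1 [Th1 h1j yh1]] := etri_half_base_change (x' := x1) (y' := y1)
  (etri_split_op A1 A2) (prj2_inj2 A1 A2) T; first by rewrite d1E.
rewrite d1E in Th2; rewrite d2E in Th1.
have [b [[b' [b'b bb']] bji nb]] := etri_unique Th2 Tm.
have b'm : b' ∘ m = j ∘ inj1 by rewrite -bji mcompA b'b mcomp1m.
exists (b ∘ (j ∘ inj2)), (h1 ∘ b'); split.
- apply: (etri_equiv Th1); exists b; split=> //; first by exists b'.
  by rewrite -mcompA b'b mcompm1.
- by rewrite -mcompA b'm mcompA h1j -mcompA prj1_inj1 mcompm1.
- by rewrite mcompA yh1 -yh2 -nb -!mcompA bb' mcompm1.
Qed.

End BaseChange.

(** * Base-closed classes of E-triangles *)

Section Classes.
Local Open Scope ring_scope.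
Variable C : extriCat.

(** [bc_comp] concerns the composite of two deflations of the class: its
    hypotheses are the data supplied by (ET4)^op. *)
Record base_closed (eta : triangle (Ext C) -> Prop) : Prop := BaseClosed {
  bc_etri : forall t, eta t -> etri t;
  bc_pull : forall (A B Z B' Z' : C) (x : mor A B) (y : mor B Z)
    (d : Ext C Z A) (c : mor Z' Z) (x' : mor A B') (y' : mor B' Z'),
    eta (Tri x y d) -> etri (Tri x' y' (pull c d)) ->
    eta (Tri x' y' (pull c d));
  bc_comp : forall (A B Z D F H : C)
    (f' : mor D B) (f : mor B A) (d : Ext C A D)
    (g' : mor F Z) (g : mor Z B) (d' : Ext C B F)
    (h' : mor H Z) (d'' : Ext C A H) (u : mor H D) (v : mor F H),
    eta (Tri f' f d) -> eta (Tri g' g d') -> etri (Tri h' (f ∘ g) d'') ->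
    g ∘ h' = f' ∘ u -> h' ∘ v = g' -> etri (Tri v u (pull f' d')) ->
    push u d'' = d -> pull f d'' = push v d' ->
    eta (Tri h' (f ∘ g) d'')
}.

Lemma base_closed_and (eta1 eta2 : triangle (Ext C) -> Prop) :
  base_closed eta1 -> base_closed eta2 ->
  base_closed (fun t => eta1 t /\ eta2 t).
Proof.
move=> [e1 p1 c1] [e2 p2 c2]; split=> [t []|A B Z B' Z' x y d c x' y' []|].
- by move=> /e1.
- by move=> t1 t2 T; split; [apply: p1 t1 T | apply: p2 t2 T].
- move=> A B Z D F H f' f d g' g d' h' d'' u v [t1 t2] [t1' t2'] T e3 e4 T' e5 e6.
  by split; [apply: c1 t1 t1' _ e3 e4 _ e5 e6 | apply: c2 t2 t2' _ e3 e4 _ e5 e6].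
Qed.

(** For a composite of deflations, the base change of d'' along f is the cobase
    change v_* d', which lies in xi; so saturation along f applies. *)
Lemma base_closed_proper (xi : triangle (Ext C) -> Prop) :
  proper_class xi -> base_closed xi.
Proof.
move=> hxi; split; first exact: proper_etri hxi.
  exact: proper_base_change hxi.
move=> A B Z D F H f' f d g' g d' h' d'' u v tf tg T _ _ _ _ pd''.
have [M [m [n Tm]]] := etri_exists (pull f d'').
apply: (proper_saturated hxi T tf (m := m) (n := n)).
by rewrite pd'' in Tm *; apply: (proper_cobase_change hxi tg).
Qed.

Variable W : C -> Prop.

(** By the long exact sequence, lifting all maps V -> Z means that every h^* d
    vanishes; exactness in the middle holds for every E-triangle. *)
Lemma from_exactP (A B Z : C) (x : mor A B) (y : mor B Z) (d : Ext C Z A) :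
  etri (Tri x y d) ->
  from_exact W (Tri x y d) <-> forall V, W V ->
    (forall h : mor V A, x ∘ h = 0 -> h = 0) /\
    (forall h : mor V Z, pull h d = 0).
Proof.
move=> T; split=> hW V /hW.
  move=> [/= inj _ sur]; split=> h.
    by move=> xh; apply: inj; rewrite xh mcompm0.
  by have [r ->] := sur h; rewrite pull_comp (etri_pull_y T) pull0.
move=> [inj sur]; split=> /= [h h' e|h|h].
- by apply: subr0_eq; apply: inj; rewrite mcompBr e subrr.
- split; first exact: etri_weak_kernel T.
  by move=> [r ->]; rewrite mcompA (etri_comp0 T) mcomp0m.
- by apply: etri_lift T _.
Qed.

Lemma to_exactP (A B Z : C) (x : mor A B) (y : mor B Z) (d : Ext C Z A) :
  etri (Tri x y d) ->
  to_exact W (Tri x y d) <-> forall V, W V ->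
    (forall h : mor Z V, h ∘ y = 0 -> h = 0) /\
    (forall h : mor A V, push h d = 0).
Proof.
move=> T; split=> hW V /hW.
  move=> [/= inj _ sur]; split=> h.
    by move=> xh; apply: inj; rewrite xh mcomp0m.
  by have [r ->] := sur h; rewrite push_comp (etri_push_x T) push0.
move=> [inj sur]; split=> /= [h h' e|h|h].
- by apply: subr0_eq; apply: inj; rewrite mcompBl e subrr.
- split; first exact: etri_weak_cokernel T.
  by move=> [r ->]; rewrite -mcompA (etri_comp0 T) mcompm0.
- by apply: etri_extend T _.
Qed.

Lemma base_closed_from_exact :
  base_closed (fun t => etri t /\ from_exact W t).
Proof.
split=> [t []//|A B Z B' Z' x y d c x' y' [T /(from_exactP T) tW] T'|].
  split=> //; apply/(from_exactP T') => V /tW [inj sur].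
  have [|b [bx _]] := etri_morphism (a := idm A) (c := c) T' T.
    by rewrite push1.
  split=> h; last by rewrite -pull_comp.
  by move=> x'h; apply: inj; rewrite -[x]mcompm1 -bx -mcompA x'h mcompm0.
move=> A B Z D F H f' f d g' g d' h' d'' u v [Tf /(from_exactP Tf) fW].
move=> [Tg /(from_exactP Tg) gW] T gh hv Tuv _ pd''.
split=> //; apply/(from_exactP T) => V WV.
have [finj fsur] := fW V WV; have [ginj gsur] := gW V WV; split=> h.
  move=> h'h; have [] := etri_weak_kernel (h := h) Tuv.
    by apply: finj; rewrite mcompA -gh -mcompA h'h mcompm0.
  move=> w wE; rewrite wE (ginj w) ?mcompm0 //.
  by rewrite -hv -mcompA -wE.
have [r ->] := etri_lift Tf (fsur h).
by rewrite pull_comp pd'' -push_pull gsur push0.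
Qed.

(** There is an E-triangle H -> Z' (+) B -> Z such that H -> Z' is the deflation
    of a realization of c^* d:
    the deflation Z' (+) B -> Z is the composite of the base change
    Z' (+) B -> Z' (+) Z of y with the split deflation (-c, 1), and
    (ET4)^op provides the rest.  If h kills H -> Z', then h extended to
    Z' (+) B factors through some r : Z -> V.  Comparing components gives
    h = - r c and r y = 0, hence r = 0 and h = 0. *)
Lemma base_change_relative_epi (A B Z B' Z' V : C)
    (x : mor A B) (y : mor B Z) (d : Ext C Z A) (c : mor Z' Z)
    (x' : mor A B') (y' : mor B' Z') :
  etri (Tri x y d) -> etri (Tri x' y' (pull c d)) ->
  (forall h : mor Z V, h ∘ y = 0 -> h = 0) ->
  forall h : mor Z' V, h ∘ y' = 0 -> h = 0.
Proof.
move=> T T' yepi h hy'.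
have [|k [g [Tg gi gy]]] := etri_base_change (m := inj1) (n := prj2)
  (etri_split Z' Z) T; first by rewrite pull0; exact: etri_split.
(* The split E-triangle with deflation f = (-c, 1) and inflation f' = (1, c),
   the graph of c. *)
pose f : mor (Z' ⊕ Z) Z := prj2 - c ∘ prj1.
pose f' : mor Z' (Z' ⊕ Z) := inj1 + inj2 ∘ c.
have prj1f' : prj1 ∘ f' = idm Z'.
  by rewrite mcompDr mcompA prj1_inj1 prj1_inj2 mcomp0m addr0.
have prj2f' : prj2 ∘ f' = c.
  by rewrite mcompDr mcompA prj2_inj1 prj2_inj2 mcomp1m add0r.
have Tf : etri (Tri f' f (0 : Ext C _ _)).
  (* The shear s c carries the canonical split sequence to (f', f). *)
  pose s e : mor (Z' ⊕ Z) (Z' ⊕ Z) := idm _ + inj2 ∘ e ∘ prj1.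
  have s1 e : prj1 ∘ s e = prj1.
    by rewrite mcompDr !mcompA prj1_inj2 !mcomp0m addr0 mcompm1.
  have s2 e : prj2 ∘ s e = prj2 + e ∘ prj1.
    by rewrite mcompDr !mcompA prj2_inj2 mcomp1m mcompm1.
  have sK e e' : e + e' = 0 -> s e ∘ s e' = idm _.
    move=> ee'; apply: biprod_eq; rewrite mcompA ?s1 ?s2 mcompm1 //.
    by rewrite mcompDl s2 -mcompA s1 -addrA -mcompDl addrC [e' + e]addrC ee'
      mcomp0m add0r.
  apply: (etri_equiv (etri_split Z' Z)); exists (s c); split.
  - by exists (s (- c)); rewrite !sK ?addNr ?addrN.
  - by rewrite mcompDl -mcompA prj1_inj1 mcompm1 mcomp1m.
  - by rewrite mcompBl s2 -mcompA s1 addrK.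
have [H [h' [d'' [u [v [Th [gh [hv [Tuv _]]]]]]]]] := etri_ET4op Tf Tg.
rewrite -pull_comp prj2f' in Tuv.
have [b [_ _ y'b]] := etri_unique Tuv T'.
have hu : h ∘ u = 0 by rewrite -y'b mcompA hy' mcomp0m.
(* The first row of g is (1, prj1 g inj2), possibly with a nonzero second
   entry, so h is extended to Z' (+) B by h prj1 g instead of h prj1. *)
have [] := etri_weak_cokernel (h := h ∘ prj1 ∘ g) Th.
  by rewrite -mcompA gh mcompA -(mcompA h) prj1f' mcompm1.
move=> r rE.
have rE' i : h ∘ (prj1 ∘ (g ∘ i)) = r ∘ (f ∘ (g ∘ i)) by rewrite !mcompA rE mcompA.
have hE : h = - (r ∘ c).
  have := rE' _ inj1; rewrite gi prj1_inj1 mcompm1 => ->.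
  by rewrite mcompBl prj2_inj1 -mcompA prj1_inj1 mcompm1 sub0r mcompNr.
have fg2 : f ∘ (g ∘ inj2) = y - c ∘ (prj1 ∘ (g ∘ inj2)).
  by rewrite /f mcompBl !mcompA gy -(mcompA y) prj2_inj2 mcompm1.
rewrite hE (yepi r) ?mcomp0m ?oppr0 //; move: (rE' _ inj2).
rewrite fg2 {1}hE mcompBr mcompNl mcompA => /esym /eqP.
by rewrite !mcompA -subr_eq0 opprK subrK => /eqP.
Qed.

Lemma base_closed_to_exact : base_closed (fun t => etri t /\ to_exact W t).
Proof.
split=> [t []//|A B Z B' Z' x y d c x' y' [T /(to_exactP T) tW] T'|].
  split=> //; apply/(to_exactP T') => V /tW [epi ext]; split=> h.
    exact: base_change_relative_epi T T' epi h.
  by rewrite push_pull ext pull0.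
move=> A B Z D F H f' f d g' g d' h' d'' u v [Tf /(to_exactP Tf) fW].
move=> [Tg /(to_exactP Tg) gW] T gh hv Tuv ud'' _.
split=> //; apply/(to_exactP T) => V WV.
have [fepi fext] := fW V WV; have [gepi gext] := gW V WV; split=> h.
  by rewrite mcompA => /gepi /fepi.
have [r rE] := etri_extend Tg (gext (h ∘ v)).
have [|w wE] := etri_weak_cokernel (h := h - r ∘ h') Tuv.
  by rewrite mcompBl -mcompA hv rE subrr.
have := push_subm h (r ∘ h') d''.
by rewrite wE !push_comp ud'' fext (etri_push_x T) push0 subr0.
Qed.

End Classes.

(** * The horseshoe construction *)

Section Horseshoe.
Local Open Scope ring_scope.
Variables (C : extriCat) (eta : triangle (Ext C) -> Prop).
Hypothesis etaB : base_closed eta.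

(** Since fZ lifts to B, the base change of (x, y) along fZ splits, and so the
    base change of (gZ, fZ) along y is an E-triangle KZ -> A (+) TZ -> B.  The
    base change of (gA, fA) along the split deflation A (+) TZ -> A has middle
    term TA (+) TZ.  The composite of the two deflations onto A (+) TZ and B is
    the required one, and its hokernel is an extension of KZ by KA. *)
Lemma horseshoe_step (A B Z KA TA KZ TZ : C)
    (x : mor A B) (y : mor B Z) (d : Ext C Z A)
    (gA : mor KA TA) (fA : mor TA A) (dA : Ext C A KA)
    (gZ : mor KZ TZ) (fZ : mor TZ Z) (dZ : Ext C Z KZ) :
  etri (Tri x y d) -> eta (Tri gA fA dA) -> eta (Tri gZ fZ dZ) ->
  pull fZ d = 0 ->
  exists (K : C) (g : mor K (TA ⊕ TZ)) (f : mor (TA ⊕ TZ) B) (e : Ext C B K)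
         (x' : mor KA K) (y' : mor K KZ) (d' : Ext C KZ KA),
    eta (Tri g f e) /\ eta (Tri x' y' d').
Proof.
move=> T eA eZ fZd.
have [|k [p [Tp _ _]]] := etri_base_change (m := inj1) (n := prj2) T
  (bc_etri etaB eZ); first by rewrite fZd; exact: etri_split.
have [|k' [q [Tq _ _]]] := etri_base_change (m := inj2) (n := prj1)
  (etri_split_op A TZ) (bc_etri etaB eA).
  by rewrite pull0; exact: etri_split_op.
have etap := bc_pull etaB eZ Tp; have etaq := bc_pull etaB eA Tq.
have [K [g [e [u [v [Tg [qg [gv [Tuv [ue pe]]]]]]]]]] := etri_ET4op Tp Tq.
exists K, g, (p ∘ q), e, v, u, (pull k (pull prj1 dA)).
split; last exact: (bc_pull etaB etaq Tuv).
exact: (bc_comp etaB etap etaq Tg qg gv Tuv ue pe).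
Qed.

Section Sequence.
(* [SA] and [SZ] list the syzygies, starting with the resolved objects. *)
Variables SA SZ TA TZ : nat -> C.
Variables (gA : forall i, mor (SA i.+1) (TA i)) (fA : forall i, mor (TA i) (SA i))
  (dA : forall i, Ext C (SA i) (SA i.+1)).
Variables (gZ : forall i, mor (SZ i.+1) (TZ i)) (fZ : forall i, mor (TZ i) (SZ i))
  (dZ : forall i, Ext C (SZ i) (SZ i.+1)).
Hypothesis etaA : forall i, eta (Tri (gA i) (fA i) (dA i)).
Hypothesis etaZ : forall i, eta (Tri (gZ i) (fZ i) (dZ i)).
Hypothesis fZ_lift : forall i A B (x : mor A B) (y : mor B (SZ i)) d,
  eta (Tri x y d) -> pull (fZ i) d = 0.

(** The extension of the i-th syzygies is kept in [eta], so that [fZ_lift]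
    applies to it at the next step. *)
Record stage (i : nat) := Stage {
  stage_mid : C;
  stage_x : mor (SA i) stage_mid;
  stage_y : mor stage_mid (SZ i);
  stage_d : Ext C (SZ i) (SA i);
  stage_eta : eta (Tri stage_x stage_y stage_d)
}.

(** One horseshoe step, as data, so that the steps can be iterated by
    recursion. *)
Record link (i : nat) (s : stage i) := Link {
  next : stage i.+1;
  link_g : mor (stage_mid next) (TA i ⊕ TZ i);
  link_f : mor (TA i ⊕ TZ i) (stage_mid s);
  link_d : Ext C (stage_mid s) (stage_mid next);
  link_eta : eta (Tri link_g link_f link_d)
}.

Lemma link_exists (i : nat) (s : stage i) : exists l : link s, True.
Proof.
have [K [g [f [e [x [y [d [egf exy]]]]]]]] :=
  horseshoe_step (bc_etri etaB (stage_eta s)) (etaA i) (etaZ i)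
                 (fZ_lift (stage_eta s)).
by exists (@Link i s (Stage exy) g f e egf).
Qed.

Definition choose_link (i : nat) (s : stage i) : link s :=
  proj1_sig (constructive_indefinite_description _ (link_exists s)).

Fixpoint stages (s0 : stage 0) (i : nat) : stage i :=
  if i is j.+1 then next (choose_link (stages s0 j)) else s0.

Lemma horseshoe (s0 : stage 0) :
  exists a b, spliced eta
    (@ResSeq C (stage_mid s0) (fun i => TA i ⊕ TZ i) a b).
Proof.
pose l i := choose_link (stages s0 i).
pose K i := stage_mid (stages s0 i.+1).
pose f i : mor (TA i ⊕ TZ i) (syzygy (stage_mid s0) K i) :=
  if i is j.+1 then link_f (l j.+1) else link_f (l 0%N).
pose e i : Ext C (syzygy (stage_mid s0) K i) (K i) :=
  if i is j.+1 then link_d (l j.+1) else link_d (l 0%N).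
exists (f 0%N), (fun i => link_g (l i) ∘ f i.+1), K, f, (fun i => link_g (l i)), e.
by split=> // -[|i]; exact: link_eta.
Qed.
End Sequence.
End Horseshoe.

(** * Rigidity of exact splicings *)

Section Rigidity.
Local Open Scope ring_scope.
Variable C : extriCat.

(** The map a - 1 kills d, so it factors through x; and x kills a - 1. *)
Lemma etri_kernel_sqr0 (A B Z : C) (x : mor A B) (y : mor B Z) (d : Ext C Z A)
    (a : mor A A) : etri (Tri x y d) ->
  x ∘ a = x -> push a d = d -> (a - idm A) ∘ (a - idm A) = 0.
Proof.
move=> T xa ad; have [] := etri_extend (a := a - idm A) T.
  by rewrite push_subm ad push1 subrr.
by move=> r {1}->; rewrite -mcompA mcompBr mcompm1 xa subrr mcompm0.
Qed.

(** Although x is only a weak kernel of y, it is determined by y up to an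
    isomorphism: the comparison maps given by (ET3)^op have unipotent
    composites by [etri_kernel_sqr0]. *)
Lemma etri_kernel_iso (A A' B Z Z' : C) (x : mor A B) (y : mor B Z)
    (d : Ext C Z A) (x' : mor A' B) (y' : mor B Z') (d' : Ext C Z' A')
    (c : mor Z Z') :
  etri (Tri x y d) -> etri (Tri x' y' d') -> is_iso c -> y' = c ∘ y ->
  exists a : mor A A', is_iso a /\ x = x' ∘ a.
Proof.
move=> T T' [c' [c'c cc']] y'E.
have [|a [xa ad]] := etri_ET3op (b := idm B) (c := c) T T'.
  by rewrite mcompm1.
have [|a' [x'a' a'd]] := etri_ET3op (b := idm B) (c := c') T' T.
  by rewrite mcompm1 y'E mcompA c'c mcomp1m.
rewrite mcomp1m in xa; rewrite mcomp1m in x'a'.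
exists a; split=> //; apply: (@is_iso_sqr0 C _ _ a a').
  apply: (etri_kernel_sqr0 T); first by rewrite mcompA -x'a'.
  by rewrite push_comp ad push_pull a'd -pull_comp c'c pull1.
apply: (etri_kernel_sqr0 T'); first by rewrite mcompA -xa.
by rewrite push_comp a'd push_pull ad -pull_comp cc' pull1.
Qed.

Lemma spliced_mono (P Q : triangle (Ext C) -> Prop) (A : C) (R : res_seq A) :
  (forall t, P t -> Q t) -> spliced P R -> spliced Q R.
Proof.
move=> PQ [K [f [g [d [Pt a b]]]]]; exists K, f, g, d; split=> // i.
exact/PQ/Pt.
Qed.

(** The isomorphisms between the syzygies of the two splicings are built
    degree by degree.  An isomorphism in degree i compatible with the deflations
    gives one in degree i + 1 compatible with the inflations, and it makes the
    i-th E-triangle of the second splicing C(W,-)-exact.  Its inflation can then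
    be cancelled on maps out of objects of W, such as the terms of R, so
    the new isomorphism is compatible with the next deflations. *)
Lemma spliced_from_exact (W : C -> Prop) (P Q : triangle (Ext C) -> Prop)
    (A : C) (R : res_seq A) :
  (forall t, P t -> etri t) -> (forall t, Q t -> etri t) ->
  (forall t, P t -> from_exact W t) -> (forall i, W (res_term R i)) ->
  spliced P R -> spliced Q R -> spliced (fun t => Q t /\ from_exact W t) R.
Proof.
move=> Pe Qe Pf; case: R => T aug b /= WT.
move=> [K [f [g [d [/= Pt a0 bE]]]]] [K' [f' [g' [d' [/= Qt a0' bE']]]]].
have Pt' i := Pe _ (Pt i); have Qt' i := Qe _ (Qt i).
have from_of i (c : mor (syzygy A K i) (syzygy A K' i)) :
    is_iso c -> f' i = c ∘ f i -> from_exact W (Tri (g' i) (f' i) (d' i)).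
  move=> cI fc; have [a [[a' [_ aa']] gE]] := etri_kernel_iso (Pt' i) (Qt' i) cI fc.
  case: cI => c' [c'c cc'].
  apply/(from_exactP _ (Qt' i)) => V WV.
  have [inj sur] := proj1 (from_exactP W (Pt' i)) (Pf _ (Pt i)) V WV; split=> h.
    move=> g'h; rewrite -[h]mcomp1m -aa' -mcompA (inj (a' ∘ h)) ?mcompm0 //.
    by rewrite gE -mcompA (mcompA a) aa' mcomp1m.
  have [r rE] := etri_lift (Pt' i) (sur (c' ∘ h)).
  rewrite -[h]mcomp1m -cc' -(mcompA c) rE mcompA -fc.
  by rewrite pull_comp (etri_pull_y (Qt' i)) pull0.
have isoP i : exists c : mor (syzygy A K i) (syzygy A K' i),
    is_iso c /\ f' i = c ∘ f i.
  elim: i => [|i [c [cI fc]]].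
    exists (idm A); split; first exact: is_iso_id.
    by rewrite mcomp1m -a0 -a0'.
  have [a [aI gE]] := etri_kernel_iso (Pt' i) (Qt' i) cI fc.
  exists a; split=> //.
  have [inj _ _] := from_of i c cI fc _ (WT i.+1).
  by apply: inj; rewrite /= mcompA -gE -bE -bE'.
exists K', f', g', d'; split=> //= i; split=> //.
by have [c [cI fc]] := isoP i; apply: from_of fc.
Qed.

End Rigidity.

(** * The shifted resolution *)

Section Shift.
Local Open Scope ring_scope.
Variables (C : extriCat) (xi eta : triangle (Ext C) -> Prop) (W : C -> Prop).
Hypothesis hxi : proper_class xi.
Hypothesis hWsum : closed_finite_sums W.
Hypothesis hWker : closed_hokernels xi W.
Hypothesis etaB : base_closed eta.
Hypothesis eta_xi : forall t, eta t -> xi t.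
Hypothesis eta_from : forall t, eta t -> from_exact W t.

(** The class [eta] governs the resolutions, whereas (T), and therefore the
    E-triangle ending in the 0-th term of R1 that is built from it, are only
    known to lie in [xi]. *)
Lemma shifted_resolution (X X0 X1 : C) (x : mor X X0) (y : mor X0 X1)
    (delta : Ext C X1 X) (R0 : res_seq X0) (R1 : res_seq X1) :
  xi (Tri x y delta) ->
  (forall i, W (res_term R0 i)) -> (forall i, W (res_term R1 i)) ->
  spliced eta R0 -> spliced eta R1 ->
  exists (V : C)
         (e : mor V X)
         (d : forall i,
            mor (shifted_sum_terms V (res_term R0) (res_term R1) i.+1)
                (shifted_sum_terms V (res_term R0) (res_term R1) i))
         (u : mor V (res_term R1 1 ⊕ res_term R0 0))
         (v : mor (res_term R1 1 ⊕ res_term R0 0) (res_term R1 0))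
         (epsilon : Ext C (res_term R1 0) V),
    let R : res_seq X :=
      ResSeq (shifted_sum_terms V (res_term R0) (res_term R1)) e d in
    [/\ forall i, W (res_term R i), spliced eta R & xi (Tri u v epsilon)].
Proof.
move=> xiT; have T := proper_etri hxi xiT.
case: R0 R1 => [T0 a0 b0] [T1 a1 b1] /= WT0 WT1.
move=> [K0 [f0 [g0 [d0 [/= eta0 _ _]]]]] [K1 [f1 [g1 [d1 [/= eta1 _ _]]]]].
have [M [m [n Tm]]] := etri_exists (pull (f1 0%N) delta).
have xim := bc_pull (base_closed_proper hxi) xiT Tm.
have [k [p [Tk _ _]]] := etri_base_change T (bc_etri etaB (eta1 0%N)) Tm.
have etak := bc_pull etaB (eta1 0%N) Tk.
have lift0 i A B (z : mor A B) (w : mor B (syzygy X0 K0 i)) d :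
    eta (Tri z w d) -> pull (f0 i) d = 0.
  move=> et; have := proj1 (from_exactP W (bc_etri etaB et)) (eta_from et).
  by move=> /(_ _ (WT0 i)) [_ ->].
(* The first resolution is that of K1 0, the first syzygy of X1, hence the
   shift of the terms T1. *)
pose s0 : stage eta K1 (syzygy X0 K0) 0 := Stage etak.
have [aM [bM [K [f [g [d [/= etaM _ _]]]]]]] :=
  horseshoe (SA := K1) (TA := fun i => T1 i.+1) etaB
    (fun i => eta1 i.+1) eta0 lift0 s0.
have [V [h [eps [u [v [Th [fh [hv [Tvu [ue ne]]]]]]]]]] :=
  etri_ET4op Tm (bc_etri etaB (etaM 0%N)).
have xih := bc_comp (base_closed_proper hxi) xim (eta_xi (etaM 0%N)) Th fh hv
  Tvu ue ne.
have WV : W V by apply: hWker xih _ (WT1 0%N); apply: (proj2 hWsum).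
pose S := shifted_sum_terms V T0 T1.
pose fR i : mor (S i) (syzygy X K i) := if i is j.+1 then f j.+1 else u.
pose gR i : mor (K i) (S i) := if i is j.+1 then g j.+1 else v.
pose dR i : Ext C (syzygy X K i) (K i) :=
  if i is j.+1 then d j.+1 else pull m (d 0%N).
exists V, u, (fun i => gR i ∘ fR i.+1), h, (n ∘ f 0%N), eps; split=> //.
  by case=> [//|i]; apply: (proj2 hWsum).
exists K, fR, gR, dR; split=> // -[|i]; last exact: etaM.
exact: (bc_pull etaB (etaM 0%N) Tvu).
Qed.

End Shift.

Theorem theorem3p6 (C : extriCat) (xi : triangle (Ext C) -> Prop)
  (hxi : proper_class xi)
  (hproj : enough_projectives xi) (hinj : enough_injectives xi)
  (hwic : WIC C)
  (W : C -> Prop)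
  (hWsum : closed_finite_sums W) (hWker : closed_hokernels xi W)
  (X X0 X1 : C) (x : mor X X0) (y : mor X0 X1) (delta : Ext C X1 X)
  (hT : xi (Tri x y delta))
  (R0 : res_seq X0) (R1 : res_seq X1)
  (hR0 : proper_resolution xi W R0) (hR1 : proper_resolution xi W R1) :
  (exists (V : C)
          (e : mor V X)
          (d : forall i,
             mor (shifted_sum_terms V (res_term R0) (res_term R1) i.+1)
                 (shifted_sum_terms V (res_term R0) (res_term R1) i))
          (u : mor V (res_term R1 1 ⊕ res_term R0 0))
          (v : mor (res_term R1 1 ⊕ res_term R0 0) (res_term R1 0))
          (epsilon : Ext C (res_term R1 0) V),
     let R : res_seq X :=
       ResSeq (shifted_sum_terms V (res_term R0) (res_term R1)) e d in
     W V /\ proper_resolution xi W R /\ xi (Tri u v epsilon)) /\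
  (to_exact_seq xi W R0 -> to_exact_seq xi W R1 ->
   to_exact W (Tri x y delta) ->
   exists (V : C)
          (e : mor V X)
          (d : forall i,
             mor (shifted_sum_terms V (res_term R0) (res_term R1) i.+1)
                 (shifted_sum_terms V (res_term R0) (res_term R1) i))
          (u : mor V (res_term R1 1 ⊕ res_term R0 0))
          (v : mor (res_term R1 1 ⊕ res_term R0 0) (res_term R1 0))
          (epsilon : Ext C (res_term R1 0) V),
     let R : res_seq X :=
       ResSeq (shifted_sum_terms V (res_term R0) (res_term R1)) e d in
     W V /\ proper_resolution xi W R /\ xi (Tri u v epsilon) /\
     to_exact_seq xi W R).
Proof.
have xe := proper_etri hxi.
have [[WR0 _] F0] := hR0; have [[WR1 _] F1] := hR1.
have B1 := base_closed_and (base_closed_proper hxi) (base_closed_from_exact W).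
have B2 := base_closed_and B1 (base_closed_to_exact W).
split.
  have eta1 A (R : res_seq A) : from_exact_seq xi W R ->
      spliced (fun t => xi t /\ etri t /\ from_exact W t) R.
    by apply: spliced_mono => t [xt ft]; split; [|split; first exact: xe].
  have [||V [e [d [u [v [eps [WR SR xiV]]]]]]] :=
    shifted_resolution hxi hWsum hWker B1 _ _ hT WR0 WR1 (eta1 _ _ F0) (eta1 _ _ F1).
  - by move=> t [].
  - by move=> t [_ []].
  exists V, e, d, u, v, eps; split; first exact: (WR 0%N).
  split=> //; split; first split=> //.
    by apply: spliced_mono SR => t [].
  by apply: spliced_mono SR => t [? []].
move=> G0 G1 _.
(* A C(-,W)-exact splicing of a proper resolution has both exactness properties
   at once. *)
have eta2 A (R : res_seq A) : (forall i, W (res_term R i)) ->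
    from_exact_seq xi W R -> to_exact_seq xi W R ->
    spliced (fun t => (xi t /\ etri t /\ from_exact W t) /\
                      etri t /\ to_exact W t) R.
  move=> WR F G; apply: spliced_mono (spliced_from_exact _ _ _ WR F G) => t.
  - by move=> [[xt tt] ft]; have et := xe _ xt.
  - by move=> [/xe].
  - by move=> [/xe].
  - by move=> [].
have [||V [e [d [u [v [eps [WR SR xiV]]]]]]] :=
  shifted_resolution hxi hWsum hWker B2 _ _ hT WR0 WR1
    (eta2 _ _ WR0 F0 G0) (eta2 _ _ WR1 F1 G1).
- by move=> t [[]].
- by move=> t [[_ []]].
exists V, e, d, u, v, eps; split; first exact: (WR 0%N).
split; last first.
  by split=> //; apply: spliced_mono SR => t [[? _] []].
split; first split=> //.
  by apply: spliced_mono SR => t [[]].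
by apply: spliced_mono SR => t [[? []]].
Qed.
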